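(* For infinitely many positive integers $n$ there exists a spanoid $\mathcal S$ on $n$ elements with $\mathrm{rank}(\mathcal S)\ge n^{c}\,\mathrm{f\text{-}rank}(\mathcal S)$, where $c=\log_5 3-\log_5 2.5\ (\ge 0.113)$.
   Context: A spanoid $\mathcal S$ on a finite set $X$ is a family of pairs $(S,i)$ with $S\subseteq X$, $i\in X$ (rules). For $T\subseteq X$, $i\in X$ write $T\models i$ if there is a sequence $T=T_0,\dots,T_r$ ($r\ge0$) with $i\in T_r$ such that for each $j\in[r]$, $T_j=T_{j-1}\cup\{i_j\}$ where some $S\subseteq T_{j-1}$ has $(S,i_j)\in\mathcal S$. $\mathrm{span}(T)=\{i:T\models i\}$; $\mathrm{rank}(\mathcal S)$ is the minimum size of $T$ with $\mathrm{span}(T)=X$. A code $C\subseteq\Sigma^X$ over a finite alphabet $\Sigma$ with $|\Sigma|\ge2$ is consistent with $\mathcal S$ if for every rule $(S,i)\in\mathcal S$ there is a function $f_{S,i}$ with $c_i=f_{S,i}(c|_S)$ for all $c\in C$; $\dim C=\log|C|/\log|\Sigma|$. The functional rank $\mathrm{f\text{-}rank}(\mathcal S)$ is the supremum of $\dim C$ over all finite alphabets and all codes consistent with $\mathcal S$. *)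

(* Defs.v *)
From HB Require Import structures.
From mathcomp Require Import all_boot all_order all_algebra.
From mathcomp Require Import all_classical all_reals all_analysis.

Set Implicit Arguments.
Unset Strict Implicit.
Unset Printing Implicit Defensive.

Import Order.TTheory GRing.Theory Num.Theory.

Local Open Scope ring_scope.

Definition spanoid (X : finType) := {set ({set X} * X)}.

Section Rank.
Variables (X : finType) (S : spanoid X).

Definition derivation_step (A B : {set X}) : bool :=
  [exists r : {set X} * X, [&& r \in S, r.1 \subset A & B == r.2 |: A]].

(* [connect] is the existence of a possibly empty finite chain
   T = T_0, ..., T_r of derivation steps. *)
Definition derives (T : {set X}) (i : X) : bool :=
  [exists U : {set X}, connect derivation_step T U && (i \in U)].

Definition spanoid_span (T : {set X}) : {set X} := finset (derives T).

Definition spanning (T : {set X}) : bool := spanoid_span T == [set: X].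

(* [set: X] is always spanning (use the empty chain), so the [arg min] is a
   genuine minimizer. *)
Definition spanoid_rank : nat :=
  #|[arg min_(T < [set: X] | spanning T) #|T| ]%N|.

End Rank.

Section FunctionalRank.
Variables (X : finType) (S : spanoid X).

Definition restriction (Sigma : finType) (A : {set X}) (c : {ffun X -> Sigma}) :
    {ffun {x : X | x \in A} -> Sigma} :=
  [ffun x => c (val x)].

Definition consistent (Sigma : finType) (C : {set {ffun X -> Sigma}}) : Prop :=
  forall (A : {set X}) (i : X), (A, i) \in S ->
    exists f : {ffun {x : X | x \in A} -> Sigma} -> Sigma,
      forall c : {ffun X -> Sigma}, c \in C -> c i = f (restriction A c).

Definition code_dim (R : realType) (Sigma : finType)
    (C : {set {ffun X -> Sigma}}) : R :=
  ln (#|C|%:R : R) / ln (#|Sigma|%:R : R).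

(* Codes are required to be nonempty because log 0 is undefined, whereas
   [ln 0 = 0] in the library. The supremum is taken in the extended reals, so
   that no default value is involved. *)
Definition f_rank (R : realType) : \bar R :=
  ereal_sup [set d : \bar R | exists (Sigma : finType)
      (C : {set {ffun X -> Sigma}}),
    [/\ (1 < #|Sigma|)%N, (0 < #|C|)%N, consistent C
      & d = (code_dim R C)%:E]]%classic.

End FunctionalRank.

Definition log_base (R : realType) (b x : R) : R := ln x / ln b.

Definition gap_exponent (R : realType) : R :=
  log_base 5%:R 3%:R - log_base 5%:R (5%:R / 2%:R).

(* Main.v *)
Require Import Defs.
From HB Require Import structures.
From mathcomp Require Import all_boot all_order all_algebra.
From mathcomp Require Import all_classical all_reals all_analysis.
From mathcomp Require Import fintype finset zify ring lra.

Set Implicit Arguments.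
Unset Strict Implicit.
Unset Printing Implicit Defensive.

Import Order.TTheory GRing.Theory Num.Theory.

Local Open Scope ring_scope.

(** On the 5-cycle, let every vertex be determined by its two neighbours: the
    rank is the vertex cover number 3, whereas a Cauchy-Schwarz count shows
    that the functional rank is at most 5/2. The semidirect product of two
    spanoids (copies of the second, indexed by the points of the first, with
    the first acting on whole copies) multiplies ranks from below and
    functional ranks from above, so the [k]-th power of the 5-cycle lives on
    [n = 5 ^ k] points and has a gap of at least [(6/5) ^ k = n ^ c]. *)

(** * Closed sets, spans and rank *)

Section Span.
Variables (X : finType) (S : spanoid X).
Local Open Scope nat_scope.

Definition rule_closed (U : {set X}) : Prop :=
  forall A i, (A, i) \in S -> A \subset U -> i \in U.

(** Induction along the derivation chain. This is the tool for rank lower bounds: a closed proper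
    superset of [T] shows that [T] does not span. *)
Lemma span_min (T U : {set X}) :
  rule_closed U -> T \subset U -> spanoid_span S T \subset U.
Proof.
move=> clU sTU; apply/subsetP=> i; rewrite inE => /existsP[V /andP[cTV iV]].
suff sVU : V \subset U by apply: (subsetP sVU).
case/connectP: cTV => p + ->; elim: p T sTU {iV} => [|W p IH] T sTU //=.
case/andP=> /existsP[[A j] /and3P[/= rS sAT /eqP ->]] /IH; apply.
by rewrite subUset sub1set sTU andbT (clU A) // (subset_trans sAT).
Qed.

Lemma sub_span (T : {set X}) : T \subset spanoid_span S T.
Proof.
apply/subsetP=> i iT; rewrite inE; apply/existsP; exists T.
by rewrite connect0.
Qed.

(* A reachable set of maximal size is closed, hence equals the span. *)
Lemma span_closed (T : {set X}) : rule_closed (spanoid_span S T).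
Proof.
case: (@arg_maxnP _ T (connect (derivation_step S) T)
  (fun U : {set X} => #|U|) (connect0 _ _)) => U TU maxU.
have clU : rule_closed U.
  move=> A i rS sAU; have : connect (derivation_step S) T (i |: U).
    apply: (connect_trans TU); apply: connect1; apply/existsP.
    by exists (A, i); rewrite /= rS sAU eqxx.
  by move/maxU; rewrite /= cardsU1; case: (i \in U) => //; rewrite add1n ltnn.
have sTU : T \subset U.
  apply/subsetP=> i; case/connectP: TU => p + ->.
  elim: p T {maxU} => [|W p IH] T //= /andP[+ pW] iT.
  by case/existsP=> r /and3P[_ _ /eqP eW]; apply: IH pW _; rewrite eW !inE iT orbT.
suff -> : spanoid_span S T = U by [].
apply/eqP; rewrite eqEsubset span_min //=.
by apply/subsetP=> i iU; rewrite inE; apply/existsP; exists U; rewrite TU.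
Qed.

Lemma spanning_setT : spanning S [set: X].
Proof. by rewrite /spanning eqEsubset subsetT sub_span. Qed.

Lemma rank_leq_card (T : {set X}) : spanning S T -> spanoid_rank S <= #|T|.
Proof.
move=> spT; rewrite /spanoid_rank.
by case: arg_minnP => [|U _ minU]; [exact: spanning_setT | exact: minU].
Qed.

Lemma leq_rank (m : nat) :
  (forall T : {set X}, spanning S T -> m <= #|T|) -> m <= spanoid_rank S.
Proof.
move=> lem; rewrite /spanoid_rank.
by case: arg_minnP => [|U spU _]; [exact: spanning_setT | exact: lem].
Qed.

End Span.

(** * Consistent codes and bounds on the functional rank *)

Section Consistency.
Variables (X : finType) (S : spanoid X).

(** The recovery function looks up any codeword with the given restriction; a fixed codeword [c0]
    supplies its value where there is none. *)
Lemma consistentE (Sigma : finType) (C : {set {ffun X -> Sigma}}) :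
  (0 < #|C|)%N ->
  consistent S C <-> forall A i, (A, i) \in S ->
    {in C &, forall c d : {ffun X -> Sigma}, {in A, c =1 d} -> c i = d i}.
Proof.
case/card_gt0P=> c0 c0C; split=> [conC A i rS c d cC dC ecd|detC A i rS].
  have [f fP] := conC A i rS; rewrite !fP //; congr f; apply/ffunP=> -[x xA].
  by rewrite !ffunE /= ecd.
exists (fun u => if [pick c in C | restriction A c == u] is Some c then c i
                 else c0 i) => c cC.
case: pickP => [d /andP[dC /eqP edc]|/(_ c)]; last by rewrite cC eqxx.
apply: (detC A) => // x xA.
by move/ffunP/(_ (exist _ x xA)): edc; rewrite !ffunE /= => ->.
Qed.

(* [code_bound p q] says that every consistent code has dimension at most
   [p / q]. *)
Definition code_bound (p q : nat) : Prop :=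
  forall (Sigma : finType) (C : {set {ffun X -> Sigma}}),
  (0 < #|C|)%N -> consistent S C -> (#|C| ^ q <= #|Sigma| ^ p)%N.

Lemma f_rank_ub (R : realType) (p q : nat) : (0 < q)%N -> code_bound p q ->
  (f_rank S R <= (p%:R / q%:R : R)%:E)%E.
Proof.
move=> q0 bd; apply: ge_ereal_sup => _ [Sigma [C [Sig1 C0 conC ->]]].
have lnS : 0 < ln (#|Sigma|%:R : R) by rewrite ln_gt0 // ltr1n.
rewrite lee_fin /code_dim ler_pdivrMr // mulrAC ler_pdivlMr ?ltr0n //.
have S0 : (0 : R) < #|Sigma|%:R by rewrite ltr0n; apply: ltnW.
have C0' : (0 : R) < #|C|%:R by rewrite ltr0n.
rewrite mulr_natr mulr_natl -!lnXn // ler_ln ?posrE ?exprn_gt0 //.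
by rewrite -!natrX ler_nat; exact: bd.
Qed.

(* Witnessed by the repetition code over two letters. *)
Lemma f_rank_gt0 (R : realType) (x0 : X) :
  (forall A i, (A, i) \in S -> A != set0) -> (0 < f_rank S R)%E.
Proof.
move=> ne; pose C := [set [ffun _ : X => b] | b in [set: bool]].
have C2 : #|C| = 2%N.
  by rewrite card_imset ?cardsT ?card_bool // => a b /ffunP/(_ x0); rewrite !ffunE.
have ln2 : 0 < ln (2%:R : R) by rewrite ln_gt0 // ltr1n.
apply: (@lt_le_trans _ _ (1%:E : \bar R)); first by rewrite lte_fin.
apply: ereal_sup_ubound; exists bool, C; split; rewrite ?card_bool ?C2 //.
  apply/consistentE; rewrite ?C2 // => A i /ne/set0Pn[x xA].
  move=> _ _ /imsetP[a _ ->] /imsetP[b _ ->] /(_ x xA).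
  by rewrite !ffunE.
by rewrite /code_dim card_bool C2 divff // gt_eqF.
Qed.

End Consistency.

(** * Semidirect products of spanoids *)

Definition row (X1 X2 : finType) (T : {set X1 * X2}) (x : X1) : {set X2} :=
  [set y | (x, y) \in T].

Lemma card_rows (X1 X2 : finType) (T : {set X1 * X2}) :
  #|T| = (\sum_x #|row T x|)%N.
Proof.
rewrite -sum1_card (eq_bigr (fun x => \sum_(y in row T x) 1)%N) => [|x _].
  rewrite (pair_big_dep xpredT (fun x y => y \in row T x)) /=.
  by apply: eq_bigl => -[x y]; rewrite inE.
by rewrite sum1_card.
Qed.

Section SemidirectProduct.
Variables (X1 X2 : finType) (S1 : spanoid X1) (S2 : spanoid X2).
Local Open Scope nat_scope.

(* Each row {x} * X2 is a copy of S2, and S1 acts on completely known rows. *)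
Definition semidirect : spanoid (X1 * X2)%type :=
  [set (setX [set xr.1] xr.2.1, (xr.1, xr.2.2)) |
     xr : X1 * ({set X2} * X2) in [set xr | xr.2 \in S2]] :|:
  [set (setX ry.1.1 [set: X2], (ry.1.2, ry.2)) |
     ry : ({set X1} * X1) * X2 in [set ry | ry.1 \in S1]].

Lemma semidirect_row x A j :
  (A, j) \in S2 -> (setX [set x] A, (x, j)) \in semidirect.
Proof.
move=> rS; rewrite inE; apply/orP; left; apply/imsetP.
by exists (x, (A, j)); rewrite ?inE.
Qed.

Lemma semidirect_rows A i y :
  (A, i) \in S1 -> (setX A [set: X2], (i, y)) \in semidirect.
Proof.
move=> rS; rewrite inE; apply/orP; right; apply/imsetP.
by exists ((A, i), y); rewrite ?inE.
Qed.

Lemma semidirect_ind (P : {set X1 * X2} -> X1 * X2 -> Prop) :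
  (forall x A j, (A, j) \in S2 -> P (setX [set x] A) (x, j)) ->
  (forall A i y, (A, i) \in S1 -> P (setX A [set: X2]) (i, y)) ->
  forall A z, (A, z) \in semidirect -> P A z.
Proof.
move=> P2 P1 A z; rewrite inE => /orP[] /imsetP[].
  by move=> [x [B j]]; rewrite inE => rS [-> ->]; apply: P2.
by move=> [[B i] y]; rewrite inE => rS [-> ->]; apply: P1.
Qed.

Lemma semidirect_premise_neq0 (y0 : X2) :
  (forall A i, (A, i) \in S1 -> A != set0) ->
  (forall A i, (A, i) \in S2 -> A != set0) ->
  forall A i, (A, i) \in semidirect -> A != set0.
Proof.
move=> ne1 ne2; apply: semidirect_ind => [x A j /ne2|A i y /ne1] /set0Pn[z zA].
  by apply/set0Pn; exists (x, z); rewrite !inE eqxx.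
by apply/set0Pn; exists (z, y0); rewrite !inE zA.
Qed.

(* If T spans, the rows of T that span X2 on their own must span X1. *)
Lemma semidirect_rank :
  spanoid_rank S1 * spanoid_rank S2 <= spanoid_rank semidirect.
Proof.
apply: leq_rank => T /eqP spT.
pose A := [set x | spanning S2 (row T x)].
(* An upper bound for the span of [T]: points whose row is reached by [S1] from the rows in [A], or
   that are spanned within their own row. *)
pose U := [set z : X1 * X2 |
  (z.1 \in spanoid_span S1 A) || (z.2 \in spanoid_span S2 (row T z.1))].
(* If [S1] does not reach [x], the whole row is spanned from within, which puts [x] in [A] after
   all. *)
have fullU x : (forall y, (x, y) \in U) -> x \in spanoid_span S1 A.
  move=> xU; apply/idPn=> nx; case/negP: (nx).
  apply: (subsetP (sub_span S1 A)); rewrite inE; apply/eqP/setP=> y.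
  by move: (xU y); rewrite [_ \in U]inE /= (negPf nx) in_setT.
have clU : rule_closed semidirect U.
  apply: semidirect_ind => [x B j rS sBU|B i y rS sBU]; rewrite [_ \in U]inE /=.
    have [//|nx] /= := boolP (x \in _).
    apply: (span_closed rS); apply/subsetP=> y yB.
    have: (x, y) \in U by apply: (subsetP sBU); rewrite !inE eqxx.
    by rewrite [_ \in U]inE /= (negPf nx).
  apply/orP; left; apply: (span_closed rS); apply/subsetP=> x xB.
  by apply: fullU => z; apply: (subsetP sBU); rewrite !inE xB.
have TU : T \subset U.
  apply/subsetP=> -[x y] xyT; rewrite [_ \in U]inE; apply/orP; right.
  by apply: (subsetP (sub_span _ _)); rewrite inE.
have /rank_leq_card leA : spanning S1 A.
  apply/eqP/setP=> x; rewrite [RHS]inE; apply: fullU => y.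
  by apply: (subsetP (span_min clU TU)); rewrite spT inE.
apply: (leq_trans (leq_mul leA (leqnn _))).
rewrite card_rows (bigID (mem A)) /= -sum_nat_const.
by apply: leq_trans (leq_addr _ _); apply: leq_sum => x; rewrite inE => /rank_leq_card.
Qed.

(* A consistent code is also a code over X1 whose letters are the rows; the
   number of letters is at most the size of a code consistent with S2. *)
Lemma semidirect_code_bound (x0 : X1) p1 q1 p2 q2 :
  code_bound S1 p1 q1 -> code_bound S2 p2 q2 ->
  code_bound semidirect (p1 * p2) (q1 * q2).
Proof.
move=> bd1 bd2 Sigma C C0 /(consistentE _ C0) conC.
pose fibre x (c : {ffun X1 * X2 -> Sigma}) := [ffun y => c (x, y)].
pose D x := fibre x @: C.
(* The code over [X1] needs one alphabet for all rows, so it is sized by the largest row code. *)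
have [xm _ maxD] := @arg_maxnP _ x0 xpredT (fun x => #|D x|) isT.
have D0 x : 0 < #|D x|.
  by case/card_gt0P: C0 => c cC; apply/card_gt0P; exists (fibre x c); apply: imset_f.
have bdD : #|D xm| ^ q2 <= #|Sigma| ^ p2.
  apply: bd2 => //; apply/consistentE => // A j rS.
  move=> _ _ /imsetP[c cC ->] /imsetP[d dC ->] e; rewrite !ffunE.
  apply: (conC _ _ (semidirect_row xm rS)) => // -[x y].
  by rewrite in_setX => /andP[/set1P -> /e] /=; rewrite !ffunE.
have [m Dm] : exists m, #|D xm| = m.+1.
  by exists #|D xm|.-1; rewrite prednK.
(* A letter is the position of a row in an enumeration of [D x]; [inord] loses nothing because
   [#|D x| <= m.+1]. *)
pose code (c : {ffun X1 * X2 -> Sigma}) : {ffun X1 -> 'I_m.+1} :=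
  [ffun x => inord (index (fibre x c) (enum (D x)))].
have codeP c d x : c \in C -> d \in C ->
    code c x = code d x -> forall y, c (x, y) = d (x, y).
  move=> cC dC /(congr1 val); rewrite !ffunE /=.
  have inD e : e \in C -> fibre x e \in enum (D x).
    by move=> eC; rewrite mem_enum imset_f.
  have ltD e : e \in C -> index (fibre x e) (enum (D x)) < m.+1.
    move=> eC; rewrite -Dm; apply: leq_trans (maxD x isT).
    by rewrite cardE index_mem inD.
  rewrite !inordK ?ltD // => e y; have /ffunP/(_ y) : fibre x c = fibre x d.
    by rewrite -(nth_index (fibre x c) (inD c cC)) e nth_index // inD.
  by rewrite !ffunE.
have codeI : {in C &, injective code}.
  by move=> c d cC dC e; apply/ffunP=> -[x y]; apply: codeP; rewrite ?e.
have bdC : #|C| ^ q1 <= #|D xm| ^ p1.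
  rewrite -(card_in_imset codeI) Dm -[X in X ^ p1]card_ord; apply: bd1.
    by rewrite card_in_imset.
  apply/consistentE; first by rewrite card_in_imset.
  move=> A i rS _ _ /imsetP[c cC ->] /imsetP[d dC ->] e; rewrite !ffunE.
  congr (inord (index _ _)); apply/ffunP=> y; rewrite !ffunE.
  apply: (conC _ _ (semidirect_rows y rS)) => // -[x z].
  by rewrite in_setX => /andP[/e exd _]; exact: (codeP c d x cC dC exd z).
have expl e (a b : nat) : a <= b -> a ^ e <= b ^ e.
  by case: e => [//|e]; rewrite leq_exp2r.
(* [#|C| ^ (q1 * q2) <= #|D xm| ^ (p1 * q2) <= #|Sigma| ^ (p1 * p2)]. *)
rewrite !expnM; apply: leq_trans (expl _ _ _ bdC) _.
have -> : (#|Sigma| ^ p1) ^ p2 = (#|Sigma| ^ p2) ^ p1 by rewrite -!expnM mulnC.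
by rewrite expnAC expl.
Qed.

End SemidirectProduct.

(** * The 5-cycle *)

Definition pentagon : spanoid 'I_5 :=
  [set ([set i - 1; i + 1], i) | i : 'I_5].

Lemma pentagon_rule (i : 'I_5) : ([set i - 1; i + 1], i) \in pentagon.
Proof. exact: imset_f. Qed.

Lemma pentagon_premise_neq0 A i : (A, i) \in pentagon -> A != set0.
Proof.
case/imsetP=> j _ [-> _]; apply/set0Pn.
by exists (j - 1); rewrite !inE eqxx.
Qed.

(* A spanning set is a vertex cover of the 5-cycle: two adjacent vertices that
   are both missing can never be derived. *)
Lemma pentagon_rank : (3 <= spanoid_rank pentagon)%N.
Proof.
apply: leq_rank => T /eqP spT.
have cover i : (1 <= (i \in T) + ((i + 1)%R \in T))%N.
  rewrite addn_gt0 !lt0b; apply/negPn/negP; rewrite negb_or => /andP[niT ni1T].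
  (* A rule deriving one end of an edge has the other end among its premises. *)
  have clU : rule_closed pentagon (~: [set i; i + 1]).
    move=> _ _ /imsetP[j _ [-> ->]] /subsetP sU.
    have := sU (j - 1); have := sU (j + 1); rewrite !inE !eqxx orbT /=.
    move=> /(_ isT) n1 /(_ isT) n2; rewrite negb_or; apply/andP; split.
      by apply: contraNneq n1 => ->; rewrite eqxx orbT.
    by apply: contraNneq n2 => ->; rewrite addrK eqxx.
  have TU : T \subset ~: [set i; i + 1].
    apply/subsetP=> j jT; rewrite !inE negb_or.
    by apply/andP; split; apply: contraTneq jT => ->.
  by move/subsetP: (span_min clU TU) => /(_ i); rewrite spT !inE eqxx => /(_ isT).
have cT : (\sum_(i : 'I_5) (i \in T) = #|T|)%N.
  by rewrite -big_mkcond sum1_card.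
have cT1 : (\sum_(i : 'I_5) ((i + 1)%R \in T) = #|T|)%N.
  by rewrite -cT [RHS](reindex_inj (addIr 1)).
(* Five edges, each vertex covering two of them: [5 <= 2 * #|T|], hence [#|T| >= 3]. *)
have : (\sum_(i : 'I_5) 1 <= \sum_(i : 'I_5) ((i \in T) + ((i + 1)%R \in T)))%N.
  by apply: leq_sum => i _; exact: cover.
rewrite big_split /= sum1_card card_ord.
by rewrite cT cT1; case: #|T| => [|[|[|]]].
Qed.

(** Cauchy-Schwarz without square roots: the hypotheses give [N i ^ 2 <= m * (a i * b i)];
    multiplying this for [i] and [j] and applying AM-GM bounds [2 * (N i * N j)], and one sums over
    all pairs. *)
Lemma sum_sqr_leq (I : finType) (N a b : I -> nat) (m : nat) :
  (forall i, N i <= a i * b i)%N -> (forall i, N i <= m)%N ->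
  ((\sum_i N i) ^ 2 <= m * ((\sum_i a i) * (\sum_i b i)))%N.
Proof.
move=> Nab Nm.
have pair i j : (2 * (N i * N j) <= m * (a i * b j + b i * a j))%N.
  rewrite -leq_sqr expnMn [X in (_ <= X)%N]expnMn.
  apply: (@leq_trans (m ^ 2 * (4 * ((a i * b j) * (b i * a j))))%N); last first.
    by rewrite leq_mul2l nat_AGM2 orbT.
  have := leq_mul (leq_mul (Nab i) (Nab j)) (leq_mul (Nm i) (Nm j)).
  by rewrite -!mulnn; lia.
have dist (u v : I -> nat) :
    ((\sum_i u i) * (\sum_i v i) = \sum_i \sum_j u i * v j)%N.
  by rewrite big_distrl; apply: eq_bigr => i _; rewrite big_distrr.
rewrite -(@leq_pmul2l 2) // -mulnn dist.
apply: (@leq_trans (\sum_i \sum_j m * (a i * b j + b i * a j)))%N.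
  rewrite big_distrr; apply: leq_sum => i _ /=.
  by rewrite big_distrr; apply: leq_sum.
under eq_bigr do rewrite -big_distrr big_split /=.
rewrite -big_distrr big_split /= -!dist; lia.
Qed.

(* Codewords are grouped by their values [p] at the vertices 0 and 1. With [a]
   and [b] values at 4 and 2, the group has at most [a * b] members, as 3 is
   determined by 2 and 4, and at most [#|Sigma|] members, as the value at 3
   determines the rest. The sum of [a] over all groups is at most
   [#|Sigma| ^ 2], because 1 and 4 determine 0; likewise for [b]. *)
Lemma pentagon_code_bound : code_bound pentagon 5 2.
Proof.
move=> Sigma C C0 /(consistentE _ C0) conC.
have det (i j k : 'I_5) (c d : {ffun 'I_5 -> Sigma}) :
    val j = val (i - 1) -> val k = val (i + 1) -> c \in C -> d \in C ->
    c j = d j -> c k = d k -> c i = d i.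
  move=> /val_inj -> /val_inj -> cC dC e1 e2.
  apply: (conC _ _ (pentagon_rule i)) => // x.
  by rewrite !inE => /orP[] /eqP ->.
pose v0 : 'I_5 := 0; pose v1 : 'I_5 := 1; pose v2 : 'I_5 := 2%:R.
pose v3 : 'I_5 := 3%:R; pose v4 : 'I_5 := 4%:R.
have ext (c d : {ffun 'I_5 -> Sigma}) : c v0 = d v0 -> c v1 = d v1 ->
    c v2 = d v2 -> c v3 = d v3 -> c v4 = d v4 -> c = d.
  move=> e0 e1 e2 e3 e4; apply/ffunP=> i.
  have : i \in [:: v0; v1; v2; v3; v4] by case: i; do 5?[case=> //].
  by rewrite !inE => /or4P[/eqP->|/eqP->|/eqP->|/orP[]/eqP->].
pose pr (c : {ffun 'I_5 -> Sigma}) := (c v0, c v1).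
(* [row (D k) p] is the set of values at vertex [k] within the group [F p]. *)
pose D (k : 'I_5) := [set (pr c, c k) | c in C].
pose F p := [set c in C | pr c == p].
have cardF : #|C| = (\sum_p #|F p|)%N.
  rewrite -sum1_card (partition_big pr xpredT) //=; apply: eq_bigr => p _.
  by rewrite -sum1_card; apply: eq_bigl => c; rewrite inE.
have F_ab p : (#|F p| <= #|row (D v4) p| * #|row (D v2) p|)%N.
  rewrite -cardsX.
  rewrite -(@card_in_imset _ _ (fun c : {ffun 'I_5 -> Sigma} => (c v4, c v2))).
    apply/subset_leq_card/subsetP=> _ /imsetP[c + ->].
    by rewrite !inE => /andP[cC /eqP <-]; rewrite !imset_f.
  move=> c d; rewrite !inE => /andP[cC /eqP <-] /andP[dC /eqP[e0 e1]] [e4 e2].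
  by apply: ext => //; apply: (det v3 v2 v4).
have F_m p : (#|F p| <= #|Sigma|)%N.
  rewrite -(@card_in_imset _ _ (fun c : {ffun 'I_5 -> Sigma} => c v3)).
    exact: max_card.
  move=> c d; rewrite !inE => /andP[cC /eqP <-] /andP[dC /eqP[e0 e1]] e3.
  by apply: ext => //; [apply: (det v2 v1 v3) | apply: (det v4 v3 v0)].
have D4 : (\sum_p #|row (D v4) p| <= #|Sigma| * #|Sigma|)%N.
  rewrite -card_rows -card_prod.
  rewrite -(@card_in_imset _ _ (fun t : Sigma * Sigma * Sigma => (t.1.2, t.2))).
    exact: max_card.
  move=> _ _ /imsetP[c cC ->] /imsetP[d dC ->] /= [e1 e4].
  by rewrite /pr e1 e4 (det v0 v4 v1 c d).
have D2 : (\sum_p #|row (D v2) p| <= #|Sigma| * #|Sigma|)%N.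
  rewrite -card_rows -card_prod.
  rewrite -(@card_in_imset _ _ (fun t : Sigma * Sigma * Sigma => (t.1.1, t.2))).
    exact: max_card.
  move=> _ _ /imsetP[c cC ->] /imsetP[d dC ->] /= [e0 e2].
  by rewrite /pr e0 e2 (det v1 v0 v2 c d).
(* With [m = #|Sigma|] and both sums at most [#|Sigma| ^ 2], the total is [#|Sigma| ^ 5]. *)
rewrite cardF; apply: leq_trans (sum_sqr_leq F_ab F_m) _.
apply: leq_trans (leq_mul (leqnn _) (leq_mul D4 D2)) _.
by rewrite !expnS expn0 muln1 !mulnA.
Qed.

(** * Powers of the 5-cycle *)

(** The base case is a single point without rules. Nonempty premises are carried along to keep the
    functional rank positive. *)
Lemma pentagon_power (k : nat) : exists (X : finType) (S : spanoid X),
  [/\ #|X| = (5 ^ k)%N, forall A i, (A, i) \in S -> A != set0,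
      (3 ^ k <= spanoid_rank S)%N & code_bound S (5 ^ k) (2 ^ k)].
Proof.
elim: k => [|k [X [S [cX neS rkS bdS]]]].
  exists unit, set0; split; first by rewrite card_unit.
  - by move=> A i; rewrite inE.
  - apply: leq_rank => T /eqP spT; rewrite card_gt0; apply/eqP=> T0.
    have clU : rule_closed (set0 : spanoid unit) set0 by move=> A i; rewrite inE.
    have T_sub : T \subset set0 by rewrite T0.
    by have := subsetP (span_min clU T_sub) tt; rewrite spT !in_set => /(_ isT).
  - move=> Sigma C _ _; rewrite !expn1 -[X in (_ <= X)%N]expn1 -card_unit -card_ffun.
    exact: max_card.
have /card_gt0P[x0 _] : (0 < #|X|)%N by rewrite cX expn_gt0.
exists ('I_5 * X)%type, (semidirect pentagon S); split.
- by rewrite card_prod card_ord cX expnS.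
- exact: (semidirect_premise_neq0 x0 pentagon_premise_neq0 neS).
- rewrite expnS; apply: leq_trans (semidirect_rank _ _).
  by rewrite leq_mul // pentagon_rank.
- rewrite !expnS; exact: (semidirect_code_bound ord0 pentagon_code_bound bdS).
Qed.

(** * The exponent and the final estimate *)

Section GapExponent.
Variable R : realType.

Lemma ln5_gt0 : 0 < ln (5%:R : R).
Proof. by rewrite ln_gt0 // ltr1n. Qed.

(** Since 3 divided by 5/2 is 6/5, raising 5 to the exponent gives the gap of one factor. *)
Lemma gap_exponentE : gap_exponent R * ln 5%:R = ln (6%:R / 5%:R).
Proof.
have ln5 := ln5_gt0.
rewrite /gap_exponent /log_base -mulrBl divfK ?gt_eqF //.
rewrite -ln_div ?posrE ?divr_gt0 ?ltr0n //; congr ln; lra.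
Qed.

(* 6/53 lies between 113/1000 and the exponent, since 5^59 < 6^53. *)
Lemma gap_exponent_ge : 113%:R / 1000%:R <= gap_exponent R.
Proof.
have ln5 := ln5_gt0.
have h : (5%:R : R) ^+ 6 <= (6%:R / 5%:R) ^+ 53 by lra.
suff : 6%:R * ln (5%:R : R) <= 53%:R * ln (6%:R / 5%:R).
  rewrite -gap_exponentE mulrA ler_pM2r //; lra.
have pos : 0 < (6%:R / 5%:R : R) by rewrite divr_gt0 ?ltr0n.
move: pos h; set x := _ / _ => pos h.
by rewrite !mulr_natl -!lnXn ?ltr0n // ler_ln ?posrE ?exprn_gt0 ?ltr0n.
Qed.

Lemma powR_gap (k : nat) : (5 ^ k)%:R `^ gap_exponent R = (6%:R / 5%:R) ^+ k.
Proof.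
have pos : 0 < (6%:R / 5%:R : R) by rewrite divr_gt0 ?ltr0n.
rewrite /powR natrX gt_eqF ?exprn_gt0 ?ltr0n // lnXn ?ltr0n //.
by rewrite mulrnAr gap_exponentE -lnXn // lnK // posrE exprn_gt0.
Qed.

End GapExponent.

Theorem mainTheorem5 (R : realType) :
  113%:R / 1000%:R <= gap_exponent R /\
  infinite_set [set n : nat | (0 < n)%N /\
    exists (X : finType) (S : spanoid X),
      [/\ #|X| = n,
          (0 < f_rank S R)%E
        & ((n%:R `^ gap_exponent R)%:E * f_rank S R <= (spanoid_rank S)%:R%:E)%E]]%classic.
Proof.
split; first exact: gap_exponent_ge.
move=> fin; apply: infinite_nat.
(* [expn 5] is injective, so a finite set containing every power of 5 would make [nat] finite. *)
suff -> : [set: nat]%classic = (expn 5 @^-1` [set n : nat | (0 < n)%N /\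
    exists (X : finType) (S : spanoid X),
      [/\ #|X| = n,
          (0 < f_rank S R)%E
        & ((n%:R `^ gap_exponent R)%:E * f_rank S R <= (spanoid_rank S)%:R%:E)%E]])%classic.
  apply: finite_preimage fin => a b _ _ /eqP.
  by rewrite eqn_exp2l // => /eqP.
apply/esym/seteqP; split=> // k _ /=; split; first by rewrite expn_gt0.
have [X [S [cX neS rkS bdS]]] := pentagon_power k.
have /card_gt0P[x0 _] : (0 < #|X|)%N by rewrite cX expn_gt0.
exists X, S; split=> //; first exact: (f_rank_gt0 R x0 neS).
have pos : 0 <= (6%:R / 5%:R : R) ^+ k by rewrite exprn_ge0 // divr_ge0.
rewrite powR_gap; apply: le_trans (lee_wpmul2l _ (f_rank_ub R _ bdS)) _.
- by rewrite lee_fin.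
- by rewrite expn_gt0.
(* [(6/5) ^ k] times [(5/2) ^ k] is exactly [3 ^ k]. *)
rewrite -EFinM lee_fin; apply: le_trans (_ : (3 ^ k)%:R <= _); last by rewrite ler_nat.
rewrite !natrX -expr_div_n -exprMn le_eqVlt; apply/orP; left; apply/eqP.
congr (_ ^+ _); lra.
Qed.
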